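(* Let $q \ge 2$ and $n \ge 1$ be integers, and let $C \subseteq H_q^n$ be an equidistant code with distance $d$. (a) If $C$ contains the all-zero codeword $0$ and $|C| > \max\{d^2+d+2,\, q\}$, then $d$ is even, and $C \setminus \{0\}$ is a $\Delta_q(n,d,d/2)$-system. (b) We have $$|C| \le \max\left\{ d^2+d+2,\; q,\; \left\lfloor \frac{2n}{d} \right\rfloor \right\}.$$ In particular, if $n \ge \max\left\{ \frac{d(d^2+d+2)}{2},\, \frac{dq}{2} \right\}$, then $$|C| \le \left\lfloor \frac{2n}{d} \right\rfloor.$$
   Context: $H_q^n = \{0,1,\ldots,q-1\}^n$ is the $q$-ary Hamming space; $x(i)$ denotes the $i$-th coordinate of $x$, $\mathrm{supp}(x) = \{i \in [n] : x(i) \neq 0\}$ with $[n]=\{1,\ldots,n\}$, $\mathrm{wt}(x) = |\mathrm{supp}(x)|$, and $\mathrm{d_H}(x,y) = |\{i \in [n]: x(i) \neq y(i)\}|$. The Johnson space is $J_q^{n,k} = \{x \in H_q^n : \mathrm{wt}(x) = k\}$. An equidistant code with distance $d$ is a set $C \subseteq H_q^n$ whose pairwise Hamming distances between distinct codewords take exactly one value, and this value is $d$ (so $|C|\ge 2$ and $d\ge 1$). A code $C' \subseteq J_q^{n,k}$ is a $\Delta_q(n,k,l)$-system if there is a set $D \subseteq [n]$ (the kernel) with $|D| = l$ such that (1) for any two distinct codewords $x,y \in C'$, $x(i) = y(i) \neq 0$ for all $i \in D$; and (2) the sets $\mathrm{supp}(x) \setminus D$, $x \in C'$, are pairwise disjoint.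 *)

(* Defs.v *)
From mathcomp Require Import all_boot all_order all_algebra.

Set Implicit Arguments.
Unset Strict Implicit.
Unset Printing Implicit Defensive.

(* Coordinates [n] = {1, ..., n} are indexed from 0. *)
Definition hamming_space (q n : nat) := {ffun 'I_n -> 'I_q}.

Definition zero_word (q n : nat) (hq : 0 < q) : hamming_space q n :=
  [ffun=> Ordinal hq].

(* The symbol 0 of the alphabet 'I_q is recognized by its value in nat, so that
   q need not be a successor. *)
Definition supp (q n : nat) (x : hamming_space q n) : {set 'I_n} :=
  [set i | (x i : nat) != 0].

Definition wt (q n : nat) (x : hamming_space q n) : nat := #|supp x|.

Definition dH (q n : nat) (x y : hamming_space q n) : nat :=
  #|[set i | x i != y i]|.

Definition johnson_space (q n k : nat) : {set hamming_space q n} :=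
  [set x | wt x == k].

(* 1 < #|C| makes the distance d actually attained, hence also 0 < d. *)
Definition equidistant (q n : nat) (C : {set hamming_space q n}) (d : nat) : Prop :=
  1 < #|C| /\
  forall x y, x \in C -> y \in C -> x != y -> dH x y = d.

Definition delta_system (q n k l : nat) (C : {set hamming_space q n}) : Prop :=
  C \subset johnson_space q n k /\
  exists D : {set 'I_n},
    [/\ #|D| = l,
        forall x y, x \in C -> y \in C -> x != y ->
          forall i, i \in D -> x i = y i /\ (x i : nat) <> 0
      & forall x y, x \in C -> y \in C -> x != y ->
          [disjoint supp x :\: D & supp y :\: D]].

(* Main.v *)
(* Replacing each symbol of the alphabet by a unit vector turns an equidistant
   q-ary code of distance d into an equidistant binary code of distance 2d, to
   which Deza's theorem applies: if it has more than d^2 + d + 2 words, then in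
   every column at most one word disagrees with all the others.  To see this,
   an equality of quadratic forms gives a (N - a) <= d N for the number a of
   ones in a column of a code of size N, so a <= d + 1 or a >= N - d - 1; after
   complementing the columns of the second kind, a double count shows that all
   words have the same weight, that this weight is d, and that the words are
   disjoint.  Back in the q-ary code, size > q excludes coordinates at which all
   words differ, so there is a majority word z from which at most one codeword
   deviates in each coordinate.  Hence the deviations of all the words sum to
   at most n, and averaging d <= dH x z + dH y z over pairs gives |C| d <= 2 n;
   if 0 is in C, the kernel is the support of z. *)

Require Import Defs.
From mathcomp Require Import all_boot all_order all_algebra.
From mathcomp Require Import zify ring.

Set Implicit Arguments.
Unset Strict Implicit.
Unset Printing Implicit Defensive.

Import Order.TTheory GRing.Theory Num.Theory.

(** * Symmetric differences *)

Definition symdiff (J : finType) (A B : {set J}) : {set J} :=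
  [set j | (j \in A) (+) (j \in B)].

Lemma symdiff_translate (J : finType) (H A B : {set J}) :
  symdiff (symdiff A H) (symdiff B H) = symdiff A B.
Proof.
apply/setP=> j; rewrite !inE.
by case: (j \in A); case: (j \in B); case: (j \in H).
Qed.

Lemma card_symdiff (J : finType) (A B : {set J}) :
  #|symdiff A B| = #|A :\: B| + #|B :\: A|.
Proof.
have -> : symdiff A B = (A :\: B) :|: (B :\: A).
  by apply/setP=> j; rewrite !inE; case: (j \in A); case: (j \in B).
rewrite cardsU;
  have -> : (A :\: B) :&: (B :\: A) = set0; last by rewrite cards0 subn0.
by apply/setP=> j; rewrite !inE; case: (j \in A); case: (j \in B).
Qed.

(** * Equidistant binary codes *)

Section Columns.

Variables (T J : finType) (C : {set T}).
Implicit Type f : T -> {set J}.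

Definition column f j : {set T} := [set x in C | j \in f x].

Definition degree_sum f x := \sum_(j in f x) #|column f j|.

Definition equidist f k :=
  forall x y, x \in C -> y \in C -> x != y -> #|symdiff (f x) (f y)| = 2 * k.

Section QuadraticForm.
Local Open Scope ring_scope.

(** Sum [w x * w y * #|symdiff (f x) (f y)|] over all ordered pairs. By equidistance this is -2k
    times the sum of the squares of [w]; column by column it is -2 times the left-hand side. *)
Lemma equidist_quadratic f k (w : T -> int) :
  equidist f k -> \sum_(x in C) w x = 0 ->
  \sum_j (\sum_(x in C) w x * (j \in f x)%:R) ^+ 2
  = k%:R * \sum_(x in C) w x ^+ 2.
Proof.
move=> fk w0.
have dE x y : #|symdiff (f x) (f y)|%:R =
    \sum_j ((j \in f x)%:R - (j \in f y)%:R) ^+ 2 :> int.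
  rewrite -sum1_card natr_sum big_mkcond /=; apply: eq_bigr => j _.
  by rewrite inE; case: (j \in f x); case: (j \in f y).
have E1 : \sum_(x in C) \sum_(y in C) w x * w y * #|symdiff (f x) (f y)|%:R
   = - (2 * k)%:R * \sum_(x in C) w x ^+ 2.
  (* The double sum inserted here vanishes because [w] sums to zero; its diagonal cancels the
     subtracted sum. *)
  have -> : - (2 * k)%:R * \sum_(x in C) w x ^+ 2 =
     \sum_(x in C) \sum_(y in C) (w x * w y * (2 * k)%:R)
     - (2 * k)%:R * \sum_(x in C) w x ^+ 2.
    rewrite [X in X - _]big1 ?sub0r ?mulNr // => x _.
    by rewrite -mulr_suml -mulr_sumr w0 mulr0 mul0r.
  rewrite mulr_sumr -sumrB; apply: eq_bigr => x xC.
  rewrite (bigD1 x) // [in RHS](bigD1 x) //=.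
  have -> : #|symdiff (f x) (f x)| = 0%N.
    by apply/eqP; rewrite cards_eq0; apply/eqP/setP=> j; rewrite !inE addbb.
  rewrite mulr0 add0r.
  rewrite [RHS](_ : _ = \sum_(i in C | i != x) w x * w i * (2 * k)%:R); last by ring.
  by apply: eq_bigr => y /andP[yC yx]; rewrite fk // eq_sym.
have E2 : \sum_(x in C) \sum_(y in C) w x * w y * #|symdiff (f x) (f y)|%:R
   = - 2%:R * \sum_j (\sum_(x in C) w x * (j \in f x)%:R) ^+ 2.
  under eq_bigr => x _ do under eq_bigr => y _ do rewrite dE mulr_sumr.
  under eq_bigr => x _ do rewrite exchange_big /=.
  rewrite exchange_big /= mulr_sumr; apply: eq_bigr => j _.
  have -> : \sum_(x in C) \sum_(y in C)
      w x * w y * ((j \in f x)%:R - (j \in f y)%:R) ^+ 2 =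
     \sum_(x in C) \sum_(y in C)
      ((w x * (j \in f x)%:R ^+ 2) * w y + w x * (w y * (j \in f y)%:R ^+ 2)
       - 2%:R * (w x * (j \in f x)%:R) * (w y * (j \in f y)%:R)).
    by apply: eq_bigr => x _; apply: eq_bigr => y _; ring.
  set a := \sum_(x in C) w x * _; set b := \sum_(x in C) w x * (j \in f x)%:R ^+ 2.
  rewrite (eq_bigr (fun x => w x * b - 2%:R * (w x * (j \in f x)%:R) * a)).
    by rewrite sumrB -!mulr_suml -mulr_sumr w0 -/a; ring.
  by move=> x _; rewrite sumrB big_split /= -!mulr_sumr w0 mulr0 add0r.
move: E1; rewrite E2 natrM !mulNr => /oppr_inj; rewrite -mulrA.
by move/(mulfI _); apply.
Qed.

End QuadraticForm.

Lemma column_card_bound f k j :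
  equidist f k ->
  #|column f j| * (#|C| - #|column f j|) <= k * #|C|.
Proof.
(* The quadratic form is evaluated at the weights b on A and -a off A, and only
   the contribution (a b)^2 of column j is kept. *)
move=> fk; set A := column f j; set a := #|A|; set b := #|C| - a.
have aC : a <= #|C| by apply/subset_leq_card/subsetP => x; rewrite inE => /andP[].
have CE : #|C| = a + b by rewrite /b subnKC.
pose w x : int := if j \in f x then Posz b else (- Posz a)%R.
have sumw (g : int -> int) :
    (\sum_(x in C) g (w x) = g (Posz b) * Posz a + g (- Posz a) * Posz b)%R.
  rewrite (bigID (fun x => j \in f x)) /=; congr (_ + _)%R.
    rewrite (eq_bigr (fun=> g (Posz b))); last by move=> x /andP[_ jx]; rewrite /w jx.
    rewrite sumr_const -mulr_natr natz; congr (_ * Posz _)%R.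
    by apply: eq_card => x; rewrite !inE.
  rewrite (eq_bigr (fun=> g (- Posz a)%R)); last first.
    by move=> x /andP[_ /negbTE jx]; rewrite /w jx.
  rewrite sumr_const -mulr_natr natz; congr (_ * Posz _)%R.
  rewrite /b /a -(cardsID A C); have -> : C :&: A = A.
    by apply/setIidPr/subsetP => x; rewrite inE => /andP[].
  rewrite addKn; apply: eq_card => x; rewrite !inE [LHS]/in_mem /=.
  by case: (x \in C); case: (j \in f x).
have w0 : (\sum_(x in C) w x = 0)%R.
  by rewrite (sumw id) /=; ring.
have := equidist_quadratic fk w0.
rewrite (sumw (fun z => z ^+ 2)%R) (bigD1 j) //=.
set R := (X in (_ + X = _)%R).
have R0 : (0 <= R)%R by apply: sumr_ge0 => i _; apply: sqr_ge0.
have -> : (\sum_(x in C) w x * (j \in f x)%:R = Posz b * Posz a)%R.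
  rewrite (bigID (fun x => j \in f x)) /= [X in (_ + X)%R]big1 ?addr0; last first.
    by move=> x /andP[_ /negbTE ->]; rewrite mulr0.
  rewrite (eq_bigr (fun=> Posz b)); last first.
    by move=> x /andP[_ jx]; rewrite /w jx mulr1.
  rewrite sumr_const -mulr_natr natz; congr (_ * Posz _)%R.
  by apply: eq_card => x; rewrite !inE.
move=> E.
have : ((a * b) * (a * b) <= (k * (a + b)) * (a * b)).
  rewrite -lez_nat -subr_ge0; move: R0; congr (0 <= _)%R.
  apply: (addrI ((Posz b * Posz a) ^+ 2)%R).
  by rewrite E !PoszM PoszD; ring.
rewrite CE; case: (posnP (a * b)) => [->//|ab0].
by rewrite leq_pmul2r.
Qed.

Lemma degree_sum_cap f x :
  degree_sum f x = \sum_(y in C) #|f x :&: f y|.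
Proof.
rewrite /degree_sum.
under eq_bigr => j _ do rewrite -sum1_card big_mkcond /=.
rewrite exchange_big [RHS]big_mkcond /=; apply: eq_bigr => y _.
case: ifP => yC; last by rewrite big1 // => j _; rewrite inE yC.
rewrite -sum1_card big_mkcond [RHS]big_mkcond; apply: eq_bigr => j _.
by rewrite !inE yC /=; case: (j \in f x).
Qed.

(** Sum over [y] of |A| + |B| = |A symdiff B| + 2 |A cap B| with A = [f x], B = [f y]. The term
    [y = x] contributes no distance, whence [#|C| - 1]. *)
Lemma degree_sum_equidist f k x :
  equidist f k -> x \in C ->
  #|C| * #|f x| + \sum_(y in C) #|f y| =
    2 * k * (#|C| - 1) + 2 * degree_sum f x.
Proof.
move=> fk xC; rewrite degree_sum_cap -sum_nat_const -big_split /= big_distrr /=.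
rewrite (bigD1 x) // [in RHS](bigD1 x) //= setIid.
have -> : 2 * k * (#|C| - 1) = \sum_(y in C | y != x) 2 * k.
  rewrite sum_nat_const mulnC; congr (_ * _).
  rewrite (cardsD1 x C) xC add1n subn1 /=.
  by apply: eq_card => y; rewrite !inE andbC.
rewrite addnCA mul2n -addnn; congr (_ + _); rewrite -big_split /=.
apply: eq_bigr => y /andP[yC yx].
rewrite -(fk x y) // 1?eq_sym // card_symdiff.
have := cardsID (f y) (f x); have := cardsID (f x) (f y).
rewrite [f y :&: f x]setIC; lia.
Qed.

(** If [x] were heavier than [y], then s = k + e and t = k - e with e > 0. Subtracting the two
    degree identities gives e N = Sx - Sy <= (k + e)(k + 1) - (k - e) = k^2 + e k + 2 e <= e (k^2 +
    k + 2), against the size of [C]. *)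
Lemma equidist_card_le f k x y :
  equidist f k -> k ^ 2 + k + 2 < #|C| ->
  (forall j, #|column f j| <= k.+1) ->
  x \in C -> y \in C -> #|f x| <= #|f y|.
Proof.
move=> fk hN hcol xC yC; case: (eqVneq x y) => [->//|xy].
have := degree_sum_equidist fk xC; have := degree_sum_equidist fk yC.
have := fk x y xC yC xy; rewrite card_symdiff.
have := cardsID (f y) (f x); have := cardsID (f x) (f y).
rewrite /degree_sum [\sum_(j in f x) _](big_setID (f y)) /=.
rewrite [\sum_(j in f y) _](big_setID (f x)) /=.
rewrite [f y :&: f x]setIC.
set s := #|f x :\: f y|; set t := #|f y :\: f x|.
set Sx := \sum_(j in f x :\: f y) _; set Sy := \sum_(j in f y :\: f x) _.
have hx : Sx <= s * k.+1 by rewrite -sum_nat_const; apply: leq_sum => j _.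
have hy : t <= Sy.
  rewrite /t -sum1_card; apply: leq_sum => j; rewrite inE => /andP[_ jy].
  by rewrite card_gt0; apply/set0Pn; exists y; rewrite inE yC.
rewrite leqNgt => cy cx st Ey Ex; apply/negP => lt_yx.
move: hN Ey Ex lt_yx hx hy cx cy st.
move: (#|f x|) (#|f y|) (#|_ :&: _|) s t Sx Sy (#|C|).
move: (\sum_(j in _) _) (\sum_(j in _) _).
move=> W V X Y I s t Sx Sy N hN Ey Ex lt_yx hx hy cx cy st.
have [e [se te e0]] : exists e, [/\ s = k + e, t + e = k & 0 < e].
  by exists (s - k); split; lia.
have E : (2 * e) * N + 2 * Sy = 2 * Sx.
  have XE : X = Y + 2 * e by lia.
  by move: Ex Ey; rewrite XE mulnDr; lia.
have hk : k * k <= e * (k * k) by rewrite leq_pmull.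
have : e * N <= e * (k ^ 2 + k + 2).
  by move: hx; rewrite se -mulnn mulnS mulnDl !mulnDr; lia.
by rewrite leq_pmul2l // leqNgt hN.
Qed.

(** All words have one weight w. Two words sharing a column force w > k, while the degree identity
    gives N (w - k) <= w (k + 1) - k; with w = u + k + 1 and N = p + k + 1 this reads p (u + 1) <=
    k^2, so N is too small. *)
Lemma light_columns_card_le1 f k j :
  equidist f k -> k ^ 2 + k + 2 < #|C| ->
  (forall j, #|column f j| <= k.+1) -> #|column f j| <= 1.
Proof.
move=> fk hN hcol; rewrite leqNgt; apply/negP => /card_gt1P [x [y []]].
rewrite !inE => /andP[xC jx] /andP[yC jy] xy.
have fE z : z \in C -> #|f z| = #|f x|.
  by move=> zC; apply/eqP; rewrite eqn_leq !(equidist_card_le fk).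
have := degree_sum_equidist fk xC.
rewrite (eq_bigr (fun=> #|f x|)) // sum_nat_const.
have hS : degree_sum f x <= #|f x| * k.+1.
  by rewrite -sum_nat_const; apply: leq_sum => i _.
have : 0 < #|f x :&: f y|.
  by rewrite card_gt0; apply/set0Pn; exists j; rewrite inE jx.
have := fk x y xC yC xy; rewrite card_symdiff.
have := cardsID (f y) (f x); have := cardsID (f x) (f y).
rewrite [f y :&: f x]setIC (fE y) //.
move: hS hN; move: (degree_sum f x) => S; move: #|C| => N hS hN.
move=> E1 E2 E3 I0 E.
have : k < #|f x| by lia.
move: (#|f x|) hS E => w hS E kw.
have [u wE] : exists u, w = u + k.+1 by exists (w - k.+1); lia.
have [p NE] : exists p, N = p + k.+1 by exists (N - k.+1); lia.
move: hS E hN; rewrite {}wE {}NE.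
by rewrite (_ : p + k.+1 - 1 = p + k) -?mulnn ?mulnDl ?mulnDr; lia.
Qed.

(* Deza's theorem, for binary codes whose words are given as sets of columns. *)
Theorem equidist_trivial f k j :
  equidist f k -> k ^ 2 + k + 2 < #|C| ->
  #|column f j| <= 1 \/ #|C| <= #|column f j|.+1.
Proof.
move=> fk hN.
(* The heavy columns; translating by [H] complements exactly these and keeps all distances. *)
pose H := [set i | k.+1 < #|column f i|].
pose g x := symdiff (f x) H.
have gk : equidist g k by move=> x y xC yC xy; rewrite symdiff_translate fk.
have colg i : #|column g i| =
    if i \in H then #|C| - #|column f i| else #|column f i|.
  have -> : column g i = if i \in H then C :\: column f i else column f i.
    apply/setP=> x; case: ifP => iH; rewrite [LHS]inE [i \in g x]inE iH.
      by rewrite !inE; case: (x \in C); case: (i \in f x).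
    by rewrite addbF !inE.
  case: ifP => // _; rewrite cardsD; congr (_ - _).
  by apply: eq_card => x; rewrite !inE; case: (x \in C).
have hg i : #|column g i| <= k.+1.
  rewrite colg; case: ifP; last by rewrite inE => /negbT; rewrite -leqNgt.
  rewrite inE => hi; have := column_card_bound i fk.
  have : #|column f i| <= #|C|.
    by apply/subset_leq_card/subsetP => x; rewrite inE => /andP[].
  move: hi hN; move: #|C| #|column f i| => N a hi hN aN.
  (* Otherwise a = u + k + 2 and b = v + k + 2, and a b <= k (a + b) becomes u v + 2 (u + v) + 4 <=
     k^2, whereas the size of [C] gives u + v + k + 2 > k^2. These clash since 2 k <= k^2 + 1. *)
  case: (leqP (N - a) k.+1) => // hb.
  have [b Nab] : exists b, N = a + b by exists (N - a); rewrite subnKC.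
  move: hb; rewrite {}Nab addKn in hN aN * => hb hab.
  have [u aE] : exists u, a = u + k.+2 by exists (a - k.+2); lia.
  have [v bE] : exists v, b = v + k.+2 by exists (b - k.+2); lia.
  have k1 : 2 * k <= k * k + 1 by case: (k) => // k'; rewrite mulSn mulnS; lia.
  by move: hN hab; rewrite {}aE {}bE -mulnn !mulnDl !mulnDr; lia.
have := light_columns_card_le1 j gk hN hg; rewrite colg.
by case: ifP => _; lia.
Qed.

End Columns.

(** * Codes over a q-ary alphabet *)

Section QaryCodes.

Variables (q n : nat).
Implicit Types (x y : hamming_space q n) (C : {set hamming_space q n}).

(** The positions of the ones once each symbol of [x] is replaced by its unit vector. *)
Definition graph x : {set 'I_n * 'I_q} := [set p | x p.1 == p.2].

Lemma card_graphD x y : #|graph x :\: graph y| = dH x y.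
Proof.
rewrite /dH -(@card_imset _ _ (fun i => (i, x i))); last by move=> i j [].
apply: eq_card => -[i s]; rewrite !inE /=; apply/andP/imsetP.
  by case=> ys /eqP xs; exists i; rewrite ?inE xs // eq_sym.
by case=> j; rewrite inE => xy [-> ->]; split; rewrite // eq_sym.
Qed.

Lemma dHC x y : dH x y = dH y x.
Proof. by apply: eq_card => i; rewrite !inE eq_sym. Qed.

Lemma dH_gt0 x y : x != y -> 0 < dH x y.
Proof.
move=> xy; rewrite card_gt0; apply/set0Pn.
case: (pickP (fun i => x i != y i)) => [i xyi|E]; first by exists i; rewrite inE.
by case/eqP: xy; apply/ffunP=> i; apply/eqP; have /negbFE := E i.
Qed.

Lemma dH_triangle x y z : dH x y <= dH x z + dH y z.
Proof.
apply: leq_trans (leq_card_setU _ _); apply/subset_leq_card/subsetP => i.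
by rewrite !inE; case: (eqVneq (x i) (z i)) => [->|_] //=; rewrite eq_sym.
Qed.

Lemma equidistant_gt0 C d : equidistant C d -> 0 < d.
Proof.
by case=> /card_gt1P [x [y [xC yC xy]]] hC; rewrite -(hC x y) // dH_gt0.
Qed.

Lemma equidistant_majority C d :
  equidistant C d -> maxn (d ^ 2 + d + 2) q < #|C| ->
  exists z : hamming_space q n, forall i, #|[set x in C | x i != z i]| <= 1.
Proof.
move=> [_ hC]; rewrite gtn_max => /andP[hN hq].
have gd : equidist C graph d.
  move=> x y xC yC xy.
  by rewrite card_symdiff !card_graphD [dH y x]dHC hC // addnn mul2n.
have maj i : exists s, #|[set x in C | x i != s]| <= 1.
  (* More than [q] words cannot all differ at [i]. A symbol taken twice there rules out the first
     alternative of [equidist_trivial], so it is the majority symbol. *)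
  have /dinjectivePn [x xC [y /andP[yx yC] xyi]] :
      ~~ dinjectiveb (fun x => x i) (mem C).
    apply/negP => /dinjectiveP inj; move: hq; rewrite ltnNge.
    by rewrite -(card_in_imset inj) -[X in _ <= X]card_ord max_card.
  exists (x i); case: (equidist_trivial (i, x i) gd hN).
    rewrite leqNgt => /negP[]; apply/card_gt1P; exists x, y.
    by rewrite !inE xyi eqxx eq_sym; split=> //; apply/andP.
  rewrite -(cardsID (column C graph (i, x i)) C) -addn1.
  have -> : C :&: column C graph (i, x i) = column C graph (i, x i).
    by apply/setIidPr/subsetP => z; rewrite inE => /andP[].
  rewrite leq_add2l; apply: leq_trans; apply/subset_leq_card/subsetP => z.
  by rewrite !inE /= => /andP[-> ->].
have [z hz] := fin_all_exists maj.
by exists (finfun z) => i; rewrite ffunE.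
Qed.

Lemma equidistant_card_le C d :
  equidistant C d -> maxn (d ^ 2 + d + 2) q < #|C| -> #|C| <= 2 * n %/ d.
Proof.
move=> eC hN; rewrite leq_divRL ?(equidistant_gt0 eC) //.
have [z hz] := equidistant_majority eC hN; have [C1 hC] := eC.
pose M := \sum_(x in C) dH x z.
have Mn : M <= n.
  rewrite /M /dH; under eq_bigr => x _ do rewrite -sum1_card big_mkcond.
  rewrite exchange_big /= -[X in _ <= X]card_ord -sum1_card.
  apply: leq_sum => i _; apply: leq_trans (hz i).
  rewrite -big_mkcondr -sum1_card; apply/eq_leq/eq_bigl => x.
  by rewrite !inE.
(* The triangle inequality summed over [y]; the term [2 * dH x z] balances [y = x] on the right. *)
have hx x : x \in C -> (#|C| - 1) * d + 2 * dH x z <= #|C| * dH x z + M.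
  move=> xC; rewrite /M -sum_nat_const -big_split /= [X in _ <= X](bigD1 x) //=.
  rewrite addnC mul2n -addnn leq_add2l.
  have -> : (#|C| - 1) * d = \sum_(y in C | y != x) d.
    rewrite sum_nat_const; congr (_ * _).
    rewrite (cardsD1 x C) xC add1n subn1 /=.
    by apply: eq_card => y; rewrite !inE andbC.
  apply: leq_sum => y /andP[yC yx].
  by rewrite -(hC x y) ?dH_triangle // eq_sym.
have : \sum_(x in C) ((#|C| - 1) * d + 2 * dH x z) <=
    \sum_(x in C) (#|C| * dH x z + M) by exact: leq_sum.
rewrite !big_split /= !sum_nat_const -!big_distrr /= -/M.
move: Mn C1; case: #|C| => [|[|p]] // Mn _; rewrite subn1 /= => hM.
rewrite -(@leq_pmul2l p.+1) //; apply: (@leq_trans (2 * p.+1 * M)); last first.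
  by rewrite -mulnA mulnCA leq_mul2l orbC leq_mul.
by move: hM; rewrite !mulSn !mulnDl; lia.
Qed.

Lemma equidistant_delta_system C d (hq : 0 < q) :
  equidistant C d -> zero_word n hq \in C -> maxn (d ^ 2 + d + 2) q < #|C| ->
  ~~ odd d /\ delta_system d d./2 (C :\ zero_word n hq).
Proof.
move=> eC C0 hN; have [z hz] := equidistant_majority eC hN.
have [_ hC] := eC; set o := zero_word n hq in C0 *.
have suppE x : supp x = [set i | x i != o i].
  by apply/setP=> i; rewrite !inE ffunE.
have wtd x : x \in C :\ o -> wt x = d.
  by rewrite !inE => /andP[xo xC]; rewrite -(hC x o) // /wt suppE.
pose D := supp z.
(* On [D] the zero word already deviates from [z], so no other codeword may. *)
have inD x i : x \in C :\ o -> i \in D -> x i = z i.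
  rewrite !inE => /andP[xo xC] iD; apply/eqP/contraT => xz.
  have : 1 < #|[set x in C | x i != z i]|.
    apply/card_gt1P; exists x, o; rewrite !inE xC C0 xz xo; split=> //.
    by rewrite ffunE; apply: contraNneq iD => <-.
  by rewrite ltnNge hz.
have disj x y : x \in C :\ o -> y \in C :\ o -> x != y ->
    [disjoint supp x :\: D & supp y :\: D].
  move=> /setD1P[xo xC] /setD1P[yo yC] xy.
  rewrite -setI_eq0; apply/eqP/setP => i; rewrite /D !suppE !inE.
  apply/negP => /andP[/andP[/negbNE/eqP zo xi] /andP[_ yi]].
  have : 1 < #|[set x in C | x i != z i]|.
    by apply/card_gt1P; exists x, y; rewrite !inE xC yC zo xi yi.
  by rewrite ltnNge hz.
have subD x : x \in C :\ o -> D \subset supp x.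
  move=> xC; apply/subsetP=> i iD; have := iD.
  by rewrite /D !inE (inD x).
(* Two nonzero codewords differ exactly on their supports outside [D], which are disjoint and of
   size d - |D| each. The second conjunct guards the truncated subtraction. *)
have Dd : d = 2 * (d - #|D|) /\ #|D| <= d.
  have : 1 < #|C :\ o|.
    suff : 2 < #|C| by rewrite (cardsD1 o C) C0 add1n ltnS.
    by move: hN; rewrite gtn_max => /andP[+ _]; apply: leq_ltn_trans; rewrite leq_addl.
  case/card_gt1P => x [y [xC yC xy]].
  have cD u : u \in C :\ o -> #|supp u :\: D| + #|D| = d.
    move=> uC; rewrite -(wtd u) // /wt -(cardsID D (supp u)) addnC.
    by have /setIidPr -> := subD u uC.
  have : d = #|supp x :\: D| + #|supp y :\: D|.
    have /setD1P[_ xC'] := xC; have /setD1P[_ yC'] := yC.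
    rewrite -{1}(hC x y) //.
    have := disj x y xC yC xy; rewrite -setI_eq0 => /eqP I0.
    rewrite -[RHS]subn0 -(@cards0 'I_n) -I0 -cardsU; apply: eq_card => i.
    move/setP/(_ i): I0; rewrite /D !suppE !inE.
    case: (eqVneq (z i) (o i)) => [_ | zo] /=.
      case: (eqVneq (x i) (o i)) => [->|xo] /=; first by rewrite eq_sym.
      by case: (eqVneq (y i) (o i)) => [->|//]; rewrite xo.
    by rewrite !inD ?eqxx // /D suppE inE.
  by have := cD x xC; have := cD y yC; lia.
split; first by case: Dd => -> _; rewrite oddM.
split; first by apply/subsetP => x xC; rewrite inE wtd.
exists D; split=> //.
  by case: Dd => dE Dle; rewrite -[LHS]doubleK; congr (_./2); lia.
move=> x y xC yC xy i iD; rewrite (inD x) ?(inD y) //; split=> //.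
by move: iD; rewrite inE => /eqP.
Qed.

End QaryCodes.

Theorem corollary11 (q n d : nat) (hq : 1 < q) (hn : 0 < n)
    (C : {set hamming_space q n}) (hC : equidistant C d) :
  (zero_word n (ltnW hq) \in C -> maxn (d ^ 2 + d + 2) q < #|C| ->
     ~~ odd d /\ delta_system d d./2 (C :\ zero_word n (ltnW hq)))
  /\ (#|C| <= maxn (maxn (d ^ 2 + d + 2) q) (2 * n %/ d)
      /\ ((Num.max ((d * (d ^ 2 + d + 2))%N%:R / 2%:R)
                   ((d * q)%N%:R / 2%:R) <= n%:R :> rat)%R ->
          #|C| <= 2 * n %/ d)).
Proof.
have bound : #|C| <= maxn (maxn (d ^ 2 + d + 2) q) (2 * n %/ d).
  rewrite leq_max; case: leqP => //= hN; exact: equidistant_card_le hC hN.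
split; first by move=> C0 hN; apply: equidistant_delta_system.
(* With denominators cleared, the hypothesis makes [2 * n %/ d] the largest entry of the maximum. *)
split=> //; rewrite ge_max !ler_pdivrMr ?ltr0n // -!natrM !ler_nat.
case/andP => h1 h2; apply: leq_trans bound _.
have d0 := equidistant_gt0 hC.
by rewrite !geq_max leqnn andbT !leq_divRL // ![_ * d]mulnC ![2 * n]mulnC h1 h2.
Qed.
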